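(* Let $p$ be a prime and let $A_1$ and $A_2$ be Abelian $p$-groups whose reduced parts are separable. Then $A_1$ and $A_2$ are isotypic (that is, $\mathrm{tp}(A_1)=\mathrm{tp}(A_2)$) if and only if the divisible parts of $A_1$ and $A_2$ are elementarily equivalent and the basic subgroups of $A_1$ and $A_2$ are elementarily equivalent.
   Context: Groups are considered in the first-order language of group theory; two groups are elementarily equivalent if their first-order theories coincide. For a group $G$ and a finite tuple $(g_1,\dots,g_n)$ of elements of $G$, the type $\mathrm{tp}^G(g_1,\dots,g_n)$ is the set of all first-order formulas in free variables $x_1,\dots,x_n$ that are true on $(g_1,\dots,g_n)$ in $G$. $\mathrm{tp}(G)$ is the set of all types of finite tuples of elements of $G$. Groups $G,H$ are isotypic (isotypically equivalent) if $\mathrm{tp}(G)=\mathrm{tp}(H)$. Every Abelian $p$-group $A$ decomposes as $A=D\oplus\overline A$ with $D$ divisible (the divisible part) and $\overline A$ reduced, i.e. having no nonzero divisible subgroups (the reduced part, unique up to isomorphism). A nonzero element $a$ of a $p$-group $G$ has infinite height if for every $r$ the equation $p^rx=a$ is solvable in $G$; a reduced Abelian $p$-group is separable if it has no nonzero elements of infinite height. A subgroup $G$ of $A$ is pure if $nG=G\cap nA$ for all integers $n$. A basic subgroup of an Abelian $p$-group $A$ is a pure subgroup $B$ which is a direct sum of cyclic $p$-groups and such that $A/B$ is divisible; basic subgroups exist and are unique up to isomorphism (and a basic subgroup of the reduced part $\overline A$ is isomorphic to a basic subgroup of $A$). *)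

(* Defs.v *)
From HB Require Import structures.
From mathcomp Require Import all_boot all_order all_algebra.
From mathcomp Require Import boolp classical_sets.

Set Implicit Arguments.
Unset Strict Implicit.
Unset Printing Implicit Defensive.

Import GRing.Theory.
Local Open Scope ring_scope.
Local Open Scope classical_set_scope.

(* The language of groups (multiplication, inverse, unit), with variables drawn
   from 'I_n.  A quantifier binds variable 0 of its body; variable i of the
   surrounding formula is variable i + 1 of the body. *)

Inductive gterm (n : nat) : Type :=
| GVar of 'I_n
| GOne
| GMul of gterm n & gterm n
| GInv of gterm n.

Inductive gformula : nat -> Type :=
| FEq n : gterm n -> gterm n -> gformula n
| FNot n : gformula n -> gformula n
| FAnd n : gformula n -> gformula n -> gformula n
| FOr n : gformula n -> gformula n -> gformula n
| FImp n : gformula n -> gformula n -> gformula n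
| FAll n : gformula n.+1 -> gformula n
| FEx n : gformula n.+1 -> gformula n.

(* Abelian groups are written additively, so GMul is read as +. *)

Fixpoint geval (G : zmodType) n (v : n.-tuple G) (t : gterm n) : G :=
  match t with
  | GVar i => tnth v i
  | GOne => 0
  | GMul t1 t2 => geval v t1 + geval v t2
  | GInv t1 => - geval v t1
  end.

Fixpoint gsat (G : zmodType) n (phi : gformula n) : n.-tuple G -> Prop :=
  match phi in gformula n return n.-tuple G -> Prop with
  | FEq _ t1 t2 => fun v => geval v t1 = geval v t2
  | FNot _ f => fun v => ~ gsat f v
  | FAnd _ f1 f2 => fun v => gsat f1 v /\ gsat f2 v
  | FOr _ f1 f2 => fun v => gsat f1 v \/ gsat f2 v
  | FImp _ f1 f2 => fun v => gsat f1 v -> gsat f2 v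
  | FAll _ f => fun v => forall x : G, gsat f (cons_tuple x v)
  | FEx _ f => fun v => exists x : G, gsat f (cons_tuple x v)
  end.

Definition theory (G : zmodType) : set (gformula 0) :=
  [set phi | gsat phi ([tuple] : 0.-tuple G)].

Definition elementarily_equivalent (G H : zmodType) : Prop :=
  theory G = theory H.

Definition tp (G : zmodType) n (g : n.-tuple G) : set (gformula n) :=
  [set phi | gsat phi g].

Definition types (G : zmodType) : set {n : nat & set (gformula n)} :=
  [set T | exists n (g : n.-tuple G), T = existT _ n (tp g)].

Definition isotypic (G H : zmodType) : Prop := types G = types H.

(* Subgroups are boolean predicates; since membership in an arbitrary set is
   decidable by the classical axioms of boolp, these are all the subgroups. *)

Definition subgroup_type (G : zmodType) (S : zmodClosed G) : Type :=
  {x : G | x \in S}.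

HB.instance Definition _ (G : zmodType) (S : zmodClosed G) :=
  SubChoice.on (subgroup_type S).
HB.instance Definition _ (G : zmodType) (S : zmodClosed G) :=
  [SubChoice_isSubZmodule of subgroup_type S by <:].

Definition p_group (p : nat) (G : zmodType) : Prop :=
  forall x : G, exists r : nat, x *+ p ^ r = 0.

Definition divisible (G : zmodType) : Prop :=
  forall (n : nat) (a : G), (0 < n)%N -> exists x : G, x *+ n = a.

Definition reduced (G : zmodType) : Prop :=
  forall S : zmodClosed G,
    divisible (subgroup_type S) -> forall x : G, x \in S -> x = 0.

Definition infinite_height (p : nat) (G : zmodType) (a : G) : Prop :=
  a != 0 /\ forall r : nat, exists x : G, x *+ p ^ r = a.

Definition separable (p : nat) (G : zmodType) : Prop :=
  reduced G /\ ~ exists a : G, infinite_height p a.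

(* A is the internal direct sum of D and R, D being the divisible part
   and R a reduced part of A. *)
Definition divisible_reduced_parts (A : zmodType) (D R : zmodClosed A) : Prop :=
  [/\ forall a : A, exists d r : A, [/\ d \in D, r \in R & a = d + r],
      forall a : A, a \in D -> a \in R -> a = 0,
      divisible (subgroup_type D)
    & reduced (subgroup_type R)].

Definition pure (A : zmodType) (G : zmodClosed A) : Prop :=
  forall n : int,
    [set g *~ n | g in [set g : A | g \in G]] =
    [set g : A | g \in G] `&` range (fun a : A => a *~ n).

Definition cyclic_group (G : zmodType) : Prop :=
  exists g : G, forall x : G, exists k : int, x = g *~ k.

Definition internal_direct_sum (G : zmodType) (I : eqType)
    (C : I -> zmodClosed G) : Prop :=
  (forall x : G, exists (s : seq I) (f : I -> G),
     [/\ uniq s, forall i, f i \in C i & x = \sum_(i <- s) f i]) /\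
  (forall (s : seq I) (f : I -> G),
     uniq s -> (forall i, f i \in C i) -> \sum_(i <- s) f i = 0 ->
     forall i, i \in s -> f i = 0).

Definition direct_sum_of_cyclic_p_groups (p : nat) (G : zmodType) : Prop :=
  exists (I : eqType) (C : I -> zmodClosed G),
    internal_direct_sum C /\
    forall i, cyclic_group (subgroup_type (C i)) /\
              p_group p (subgroup_type (C i)).

Definition basic_subgroup (p : nat) (A : zmodType) (B : zmodClosed A) : Prop :=
  [/\ pure B,
      direct_sum_of_cyclic_p_groups p (subgroup_type B)
    & divisible {ideal_quot B}].

(* Main.v *)
(* Height-preserving isomorphisms between finite subgroups form a back-and-forth
   system between two abelian p-groups of length at most omega whose Ulm
   quotients p^n G[p] / p^(n+1) G[p] (n finite), and whose groups of elements of
   order p and infinite height, have the same size up to identifying infinite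
   sizes (Kaplansky-Mackey, Barwise-Eklof).  Such groups are therefore isotypic.
   This applies to A1 and A2, since separability makes the elements of infinite
   height exactly the divisible part; to B1 and B2, where no nonzero element has
   infinite height; and to D1 and D2.  Finite Ulm quotients of A agree with those
   of B by purity and divisibility of A/B, those at infinity with D[p].  The
   finite ones are read off the theory, the infinite one off the types of tuples
   (or off the theory of D). *)
Require Import Defs.
From mathcomp Require Import all_boot all_order all_algebra.
From mathcomp Require Import boolp classical_sets.

Set Implicit Arguments.
Unset Strict Implicit.
Unset Printing Implicit Defensive.

Import GRing.Theory.
Local Open Scope ring_scope.

(** * Divisibility by powers of [p] and heights *)

Definition dvd_pow (p : nat) (G : zmodType) (n : nat) (x : G) : Prop :=
  exists u : G, x = u *+ p ^ n.

Definition dvd_inf (p : nat) (G : zmodType) (x : G) : Prop :=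
  forall n, dvd_pow p n x.

Section Height.
Variables (p : nat) (G : zmodType).
Implicit Types x y : G.
Local Notation dv := (dvd_pow p).

Lemma dvd_pow_zero n : dv n (0 : G).
Proof. by exists 0; rewrite mul0rn. Qed.

Lemma dvd_powD n x y : dv n x -> dv n y -> dv n (x + y).
Proof. by move=> [u ->] [w ->]; exists (u + w); rewrite mulrnDl. Qed.

Lemma dvd_powN n x : dv n x -> dv n (- x).
Proof. by move=> [u ->]; exists (- u); rewrite mulNrn. Qed.

Lemma dvd_powB n x y : dv n x -> dv n y -> dv n (x - y).
Proof. by move=> hx hy; apply: dvd_powD => //; apply: dvd_powN. Qed.

Lemma dvd_powMn n k x : dv n x -> dv n (x *+ k).
Proof. by move=> [u ->]; exists (u *+ k); rewrite mulrnAC. Qed.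

Lemma dvd_pow_le m n x : (m <= n)%N -> dv n x -> dv m x.
Proof.
move=> le_mn [u ->]; exists (u *+ p ^ (n - m)).
by rewrite -mulrnA -expnD subnK.
Qed.

Lemma dvd_pow_exp0 x : dv 0 x.
Proof. by exists x; rewrite expn0. Qed.

Lemma dvd_pow_mulp n x : dv n x -> dv n.+1 (x *+ p).
Proof. by move=> [u ->]; exists u; rewrite -mulrnA expnSr. Qed.

Lemma dvd_powS n x : dv n.+1 x -> exists2 y, dv n y & y *+ p = x.
Proof.
by move=> [u ->]; exists (u *+ p ^ n); [exists u | rewrite -mulrnA expnSr].
Qed.

Lemma dvd_pow_congl n x y : dv n y -> dv n (x + y) <-> dv n x.
Proof.
move=> hy; split=> [h|h]; last exact: dvd_powD.
by rewrite -(addrK y x); apply: dvd_powB.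
Qed.

Lemma dvd_pow_congr n x y : dv n x -> dv n (x + y) <-> dv n y.
Proof. by rewrite addrC; apply: dvd_pow_congl. Qed.

Hypotheses (p_pr : prime p) (pG : p_group p G).

(** By Bezout, [k] is invertible modulo a power of [p] that kills [x]. Hence multiples prime to [p]
    change neither vanishing nor height. *)
Lemma coprime_mulrnK k x : coprime k p -> exists j, x *+ k *+ j = x.
Proof.
have [-> | k_gt0 co_kp] := posnP k.
  by rewrite /coprime gcd0n => /eqP p1; move: p_pr; rewrite p1.
have [r xr] := pG x; have co : coprime k (p ^ r) by rewrite coprimeXr.
case: (egcdnP (p ^ r) k_gt0) => u w def_u _; exists u.
rewrite -mulrnA mulnC def_u (eqP co) mulrnDr mulnC mulrnA xr mul0rn.
by rewrite add0r.
Qed.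

Lemma coprime_dvd_pow n k x : coprime k p -> dv n (x *+ k) <-> dv n x.
Proof.
move=> co; split=> [h|]; last exact: dvd_powMn.
by have [j <-] := coprime_mulrnK x co; apply: dvd_powMn.
Qed.

Lemma coprime_mulrn_eq0 k x : coprime k p -> x *+ k = 0 <-> x = 0.
Proof.
move=> co; split=> [h|->]; last by rewrite mul0rn.
by have [j <-] := coprime_mulrnK x co; rewrite h mul0rn.
Qed.
End Height.

(** * Counting classes and the pigeonhole principle *)

(** For an equivalence [E], this says that [P] meets at least [N] classes; agreement for all finite
    [N] identifies all infinite sizes. *)
Definition at_least (N : nat) (G : Type) (P : G -> Prop) (E : G -> G -> Prop) :
    Prop :=
  exists x : 'I_N -> G,
    (forall i, P (x i)) /\ (forall i j, E (x i) (x j) -> i = j).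

(** Greedy choice from the list; as [E] is only reflexive, covering is stated in either
    direction. *)
Lemma representatives (T : eqType) (E : T -> T -> Prop) (S : seq T) :
    (forall x, E x x) ->
  exists L : seq T, [/\ uniq L, {subset L <= S},
    forall x y, x \in L -> y \in L -> E x y -> x = y
    & forall x, x \in S -> exists2 y, y \in L & E x y \/ E y x].
Proof.
move=> Exx; elim: S => [|s S [L [uL sLS injL covL]]]; first by exists [::].
have [[y yL Esy]|noE] := pselect (exists2 y, y \in L & E s y \/ E y s).
  exists L; split=> // [x /sLS xS|x]; first by rewrite inE xS orbT.
  by rewrite inE => /orP[/eqP->|/covL//]; exists y.
exists (s :: L); split=> /=.
- rewrite uL andbT; apply/negP => sL; apply: noE; exists s => //; by left.
- by move=> x; rewrite !inE => /orP[->//|/sLS->]; rewrite orbT.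
- move=> x y; rewrite !inE => /orP[/eqP->|xL] /orP[/eqP->|yL] // Exy.
  + by case: noE; exists y => //; left.
  + by case: noE; exists x => //; right.
  + exact: injL.
- move=> x; rewrite inE => /orP[/eqP->|/covL[y yL Exy]].
    by exists s; [rewrite mem_head | left].
  by exists y => //; rewrite inE yL orbT.
Qed.

(** Pigeonhole: representatives of the values of [f] on [S], together with [w], give [size L + 1]
    classes in [A], hence as many in [B]. By the hypothesis linking [f] and [g], the values of [g]
    on [S] meet at most [size L] classes, so one is missed. *)
Lemma at_least_fresh (T : eqType) (S : seq T) (A B : Type)
    (PA : A -> Prop) (EA : A -> A -> Prop) (PB : B -> Prop)
    (EB : B -> B -> Prop) (f : T -> A) (g : T -> B) (w : A) :
    (forall x, EA x x) -> (forall x y, EA x y -> EA y x) ->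
    (forall x y, EB x y -> EB y x) ->
    (forall x y z, EB x y -> EB y z -> EB x z) ->
    (forall N, at_least N PA EA -> at_least N PB EB) ->
    (forall s, s \in S -> PA (f s)) ->
    (forall s t, s \in S -> t \in S -> EA (f s) (f t) -> EB (g s) (g t)) ->
    PA w -> (forall s, s \in S -> ~ EA w (f s)) ->
  exists2 y, PB y & forall s, s \in S -> ~ EB y (g s).
Proof.
move=> rA sA sB tB tr PAf EAB PAw wS.
have [L [uL sLS injL covL]] :=
  @representatives _ (fun s t => EA (f s) (f t)) S (fun s => rA (f s)).
pose x (i : 'I_(size L).+1) :=
  if unlift ord0 i is Some j then f (tnth (in_tuple L) j) else w.
have memL j : tnth (in_tuple L) j \in L by exact: mem_tnth.
have : at_least (size L).+1 PA EA.
  exists x; split=> [i|i j]; rewrite /x.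
    by case: unliftP => [j _|_] //; apply/PAf/sLS.
  case: unliftP => [i' ->|->]; case: unliftP => [j' ->|->] // Eij.
  - by congr lift; apply: (tuple_uniqP (in_tuple L) uL); apply: injL.
  - by case: (wS _ (sLS _ (memL i'))); apply: sA.
  - by case: (wS _ (sLS _ (memL j'))).
move=> /tr[y [PBy injy]]; apply: contrapT => no_y.
have /choice[h hP] : forall i, exists j : 'I_(size L),
    EB (y i) (g (tnth (in_tuple L) j)).
  move=> i; apply: contrapT => no_j; apply: no_y; exists (y i) => // s sS Es.
  have [t tL Est] := covL s sS; apply: no_j.
  have /tnthP[j tj] : t \in in_tuple L by [].
  exists j; rewrite -tj; apply: tB Es _.
  by case: Est => Est; [|apply: sB]; apply: EAB => //; apply: sLS.
have inj_h : injective h.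
  move=> i j hij; apply: injy; apply: tB (hP i) _.
  by rewrite hij; apply/sB/hP.
by have := leq_card _ inj_h; rewrite !card_ord ltnn.
Qed.

(** * Ulm invariants and height-preserving partial isomorphisms *)

(* The n-th Ulm quotient p^n G[p] / p^(n+1) G[p] has at least N elements.
   Counting elements rather than taking dimensions keeps this visibly
   first-order and replaces linear algebra over F_p by the pigeonhole
   principle. *)
Definition ulm_at_least (p n N : nat) (G : zmodType) : Prop :=
  at_least N (fun x : G => dvd_pow p n x /\ x *+ p = 0)
    (fun x y => dvd_pow p n.+1 (x - y)).

Definition ulm_inf_at_least (p N : nat) (G : zmodType) : Prop :=
  at_least N (fun x : G => dvd_inf p x /\ x *+ p = 0) eq.

(* Equivalently, the p-groups of length at most omega in Ulm's sense. *)
Definition short_p_group (p : nat) (G : zmodType) : Prop :=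
  p_group p G /\
  forall x : G, dvd_inf p x -> exists2 y, dvd_inf p y & y *+ p = x.

Definition same_ulm (p : nat) (A B : zmodType) : Prop :=
  (forall n N, ulm_at_least p n N A <-> ulm_at_least p n N B) /\
  (forall N, ulm_inf_at_least p N A <-> ulm_inf_at_least p N B).

(** Vanishing is recorded separately: heights do not tell 0 from other elements of infinite
    height. *)
Definition same_height (p : nat) (A B : zmodType) (x : A) (y : B) : Prop :=
  (x = 0 <-> y = 0) /\ forall n, dvd_pow p n x <-> dvd_pow p n y.

(* The graph of a height-preserving isomorphism between finite subgroups. *)
Definition partial_iso (p : nat) (A B : zmodType) (g : seq (A * B)) : Prop :=
  [/\ 0 \in g, forall s t, s \in g -> t \in g -> s - t \in g
    & forall s, s \in g -> same_height p s.1 s.2].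

Lemma pair_mulrn (A B : zmodType) (s : A * B) n :
  s *+ n = (s.1 *+ n, s.2 *+ n).
Proof.
by elim: n => [|n IH]; rewrite ?mulr0n // !mulrS IH.
Qed.

(** * Calculus of partial isomorphisms and adjunction of one element *)

Section PartialIso.
Variables (p : nat) (A B : zmodType).
Implicit Types g : seq (A * B).
Local Notation dv := (dvd_pow p).

Section Graph.
Variable g : seq (A * B).
Hypothesis iso : partial_iso p g.

Lemma partial_iso0 : 0 \in g. Proof. by case: iso. Qed.

Lemma partial_isoB s t : s \in g -> t \in g -> s - t \in g.
Proof. by case: iso => _ + _; apply. Qed.

Lemma partial_isoN s : s \in g -> - s \in g.
Proof. by move=> sg; rewrite -sub0r; apply: partial_isoB partial_iso0 sg. Qed.

Lemma partial_isoD s t : s \in g -> t \in g -> s + t \in g.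
Proof.
by move=> sg tg; rewrite -[t]opprK; apply: partial_isoB sg (partial_isoN tg).
Qed.

Lemma partial_isoMn s n : s \in g -> s *+ n \in g.
Proof.
move=> sg; elim: n => [|n IH]; first exact: partial_iso0.
by rewrite mulrS; apply: partial_isoD.
Qed.

Lemma partial_iso_eq0 s : s \in g -> s.1 = 0 <-> s.2 = 0.
Proof. by case: iso => _ _ h /h[]. Qed.

Lemma partial_iso_dvd_pow s n : s \in g -> dv n s.1 <-> dv n s.2.
Proof. by case: iso => _ _ h /h[]. Qed.

Lemma partial_iso_dvd_inf s : s \in g -> dvd_inf p s.1 <-> dvd_inf p s.2.
Proof.
by move=> sg; split=> h n; apply/(partial_iso_dvd_pow n sg); apply: h.
Qed.

Lemma partial_iso_eq s t : s \in g -> t \in g -> s.1 = t.1 <-> s.2 = t.2.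
Proof.
move=> sg tg; have := partial_iso_eq0 (partial_isoB sg tg) => /= h.
by split=> /eqP; rewrite -subr_eq0 => /eqP/h/eqP; rewrite subr_eq0 => /eqP.
Qed.
End Graph.

Hypotheses (p_pr : prime p) (pA : p_group p A) (pB : p_group p B).

(** The new elements are [s + c *+ z] with [z < p]. For nonzero [z], multiplying by an inverse of
    [z] modulo [p] lands in the coset of [c] without changing height or vanishing, so that coset is
    the only new one to check. *)
Lemma adjoin_p_root g a b :
    partial_iso p g -> (a *+ p, b *+ p) \in g ->
    (forall s, s \in g -> same_height p (a + s.1) (b + s.2)) ->
  exists g', [/\ partial_iso p g', {subset g <= g'} & (a, b) \in g'].
Proof.
move=> iso cg hc; pose c := (a, b).
have {}cg : c *+ p \in g by rewrite pair_mulrn.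
have p_gt0 := prime_gt0 p_pr.
pose g' := [seq s + c *+ z | s <- g, z <- iota 0 p].
have memg' s z : s \in g -> s + c *+ z \in g'.
  move=> sg; apply/allpairsP; exists (s + c *+ p *+ (z %/ p), (z %% p)%N).
  rewrite /= mem_iota /= add0n ltn_mod p_gt0; split=> //.
    by apply: partial_isoD => //; apply: partial_isoMn.
  by rewrite -addrA -mulrnA mulnC -mulrnDr -divn_eq.
exists g'; split.
- split.
  + by have := memg' 0 0%N (partial_iso0 iso); rewrite mulr0n addr0.
  + move=> _ _ /allpairsP[[s z] /= [sg _ ->]] /allpairsP[[t w] /= [tg _ ->]].
    (* Subtracting [c *+ w] amounts to adding [c *+ (p.-1 * w)] and subtracting [c *+ p *+ w], which
       lies in the graph. *)
    suff -> : s + c *+ z - (t + c *+ w) =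
        (s - t - c *+ p *+ w) + c *+ (z + p.-1 * w).
      apply: memg'; apply: partial_isoB => //; first exact: partial_isoB.
      exact: partial_isoMn.
    have -> : c *+ p *+ w = c *+ w + c *+ (p.-1 * w).
      by rewrite -mulrnA -{1}(prednK p_gt0) mulSn mulrnDr.
    rewrite mulrnDr (addrC (c *+ z)) !opprD !addrA subrK.
    by rewrite [RHS]addrAC [in RHS](addrAC s).
  + move=> _ /allpairsP[[s z] [/= sg ltzp ->]]; set x := s + c *+ z.
    have {}ltzp : (z < p)%N by move: ltzp; rewrite mem_iota.
    have [z0|z_gt0] := posnP z.
      have -> : x = s by rewrite /x z0 mulr0n addr0.
      by case: iso => _ _; apply.
    have co_zp : coprime z p.
      by rewrite coprime_sym prime_coprime // gtnNdvd.
    (* Bezout gives [j * z = v * p + 1]. *)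
    case: (egcdnP p z_gt0) => j v; rewrite (eqP co_zp) => def_j _.
    have co_jp : coprime j p.
      apply: (@coprime_dvdl _ (j * z)); first exact: dvdn_mulr.
      by rewrite def_j /coprime gcdnC gcdnMDl gcdn1.
    have xj : x *+ j = c + (s *+ j + c *+ p *+ v).
      by rewrite mulrnDl -[c *+ z *+ j]mulrnA mulnC def_j mulrnDr mulnC mulrnA
        addrA addrC.
    have s'g : s *+ j + c *+ p *+ v \in g.
      by apply: partial_isoD => //; apply: partial_isoMn.
    have [h0 hd] : same_height p (x.1 *+ j) (x.2 *+ j).
      have -> : x.1 *+ j = (x *+ j).1 by rewrite pair_mulrn.
      have -> : x.2 *+ j = (x *+ j).2 by rewrite pair_mulrn.
      by rewrite xj; apply: hc.
    split=> [|n].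
      rewrite -(coprime_mulrn_eq0 p_pr pA _ co_jp) h0.
      exact: (coprime_mulrn_eq0 p_pr pB).
    rewrite -(coprime_dvd_pow p_pr pA _ _ co_jp) hd.
    exact: (coprime_dvd_pow p_pr pB).
- by move=> s sg; have := memg' s 0%N sg; rewrite mulr0n addr0.
- by have := memg' 0 1%N (partial_iso0 iso); rewrite mulr1n add0r.
Qed.
End PartialIso.

(** * Extension of a partial isomorphism by one element *)

Section Extension.
Variables (p : nat) (A B : zmodType).
Hypotheses (p_pr : prime p).
Hypotheses (shortA : short_p_group p A) (shortB : short_p_group p B).
Hypothesis ulmAB : forall n N, ulm_at_least p n N A -> ulm_at_least p n N B.
Hypothesis ulm_infAB :
  forall N, ulm_inf_at_least p N A -> ulm_inf_at_least p N B.
Implicit Types (g : seq (A * B)) (s t : A * B).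
Local Notation dv := (dvd_pow p).

Let pA : p_group p A := shortA.1.
Let pB : p_group p B := shortB.1.

Definition extendible g (a : A) : Prop :=
  exists g', [/\ partial_iso p g', {subset g <= g'} & exists b, (a, b) \in g'].

(** Any element of the coset of [a] modulo the domain may replace [a]; later cases use this to
    choose one of suitable height. *)
Lemma extendible_translate g a s :
  s \in g -> extendible g (a + s.1) -> extendible g a.
Proof.
move=> sg [g' [iso' sub [b bg']]]; exists g'; split=> //; exists (b - s.2).
have := partial_isoB iso' bg' (sub _ sg).
by rewrite -[_ - _]/(a + s.1 - s.1, b - s.2) addrK.
Qed.

Lemma extendible_intro g a b :
    partial_iso p g -> (a *+ p, b *+ p) \in g ->
    (forall s, s \in g -> same_height p (a + s.1) (b + s.2)) ->
  extendible g a.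
Proof.
move=> iso pabg h.
have [g' [iso' sub abg]] := adjoin_p_root p_pr pA pB iso pabg h.
by exists g'; split=> //; exists b.
Qed.

(** Adding an element of infinite height leaves heights unchanged, so the new cosets inherit
    agreement from [g]; a zero there would put [a] in the domain or [b] in the range. *)
Lemma extendible_inf_height_root g a b :
    partial_iso p g -> (a *+ p, b *+ p) \in g -> dvd_inf p a -> dvd_inf p b ->
    (forall s, s \in g -> s.1 <> a) -> (forall s, s \in g -> s.2 <> b) ->
  extendible g a.
Proof.
move=> iso pabg infa infb ag bg; apply: (extendible_intro iso pabg) => s sg.
have sNg := partial_isoN iso sg.
split=> [|m].
  split=> /eqP; rewrite addr_eq0 => /eqP eqN; exfalso.
    exact: (ag _ sNg).
  exact: (bg _ sNg).
by rewrite !dvd_pow_congr //; apply: (partial_iso_dvd_pow iso).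
Qed.

(** For [a] outside the domain: if some [s] in [g] has first component of infinite height and with
    the same multiple by [p] as [a], the difference [w] is p-torsion and counting supplies its
    partner. Otherwise any root of [b0] of infinite height is new to the range, since a preimage
    would yield such an [s]. *)
Lemma extendible_inf_height g a b0 :
    partial_iso p g -> (a *+ p, b0) \in g -> dvd_inf p a -> extendible g a.
Proof.
move=> iso pag infa.
have [[s sg sa]|ag] := pselect (exists2 s, s \in g & s.1 = a).
  by exists g; split=> //; exists s.2; rewrite -sa; case: s sg {sa}.
have [[s [sg infs ps]]|no_s] := pselect (exists s, [/\ s \in g, dvd_inf p s.1
    & s.1 *+ p = a *+ p]).
  have sNg := partial_isoN iso sg.
  apply: (extendible_translate sNg); rewrite -[(- s).1]/(- s.1).
  set w := a - _; have pw : w *+ p = 0 by rewrite mulrnBl ps subrr.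
  have infw : dvd_inf p w by move=> n; apply: dvd_powB.
  have wg t : t \in g -> t.1 <> w.
    move=> tg tw; apply: ag; exists (t + s); first exact: (partial_isoD iso).
    by rewrite -[(t + s).1]/(t.1 + s.1) tw subrK.
  (* Only graph elements of infinite height killed by [p] can collide with the partner sought. *)
  pose S := [seq s <- g | `[< dvd_inf p s.1 /\ s.1 *+ p = 0 >]].
  have [||||||||y [infy py] yS] := @at_least_fresh _ S A B
      (fun x => dvd_inf p x /\ x *+ p = 0) eq _ eq fst snd w _ _ _ _ ulm_infAB.
  - by [].
  - by [].
  - by [].
  - by move=> x y z -> ->.
  - by move=> t; rewrite mem_filter => /andP[/asboolP].
  - move=> t u; rewrite !mem_filter => /andP[_ tg] /andP[_ ug].
    by move/(partial_iso_eq iso tg ug).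
  - by [].
  - move=> t; rewrite mem_filter => /andP[_ tg] wt.
    by apply: (wg _ tg).
  apply: (extendible_inf_height_root iso _ infw infy wg) => [|t tg ty].
    by rewrite pw py; apply: partial_iso0 iso.
  have ptg := partial_isoMn iso p tg; apply: (yS t) => //.
  rewrite mem_filter tg andbT; apply/asboolP; split.
    by apply/(partial_iso_dvd_inf iso tg); rewrite ty.
  by have := partial_iso_eq0 iso ptg; rewrite pair_mulrn /= ty => ->.
have infb0 : dvd_inf p b0.
  by apply/(partial_iso_dvd_inf iso pag) => n; apply: dvd_powMn.
(* Shortness of [B] supplies the root. *)
have [b infb pb] := shortB.2 _ infb0.
apply: (@extendible_inf_height_root g a b) => // [|s sg sa|s sg sb].
- by rewrite pb.
- by apply: ag; exists s.
apply: no_s; exists s; split=> //.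
  by apply/(partial_iso_dvd_inf iso sg); rewrite sb.
have := partial_iso_eq iso (partial_isoMn iso p sg) pag.
by rewrite pair_mulrn /= => ->; rewrite sb.
Qed.

(** No element of either coset exceeds height [n], so the height of [a + s.1] is the minimum of [n]
    and the height of [s.1], and likewise in [B]. In particular neither coset contains 0. *)
Lemma extendible_finite_height n g a b :
    partial_iso p g -> (a *+ p, b *+ p) \in g -> dv n a -> dv n b ->
    (forall s, s \in g -> ~ dv n.+1 (a + s.1)) ->
    (forall s, s \in g -> ~ dv n.+1 (b + s.2)) ->
  extendible g a.
Proof.
move=> iso pabg na nb ag bg; apply: (extendible_intro iso pabg) => s sg.
split=> [|m].
  split=> eq0; exfalso.
    by apply: (ag s sg); rewrite eq0; apply: dvd_pow_zero.
  by apply: (bg s sg); rewrite eq0; apply: dvd_pow_zero.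
have [le_mn|lt_nm] := leqP m n.
  rewrite !dvd_pow_congr; first exact: (partial_iso_dvd_pow iso).
    exact: dvd_pow_le nb.
  exact: dvd_pow_le na.
split=> /(dvd_pow_le lt_nm) h; first by case: (ag s sg).
by case: (bg s sg).
Qed.

(* Here [b] is any element of height [n] with [b *+ p] prescribed: no element of
   [a + S] jumps in height when multiplied by [p], so none of [b + T] does. *)
Lemma extendible_no_jump n g a b0 :
    partial_iso p g -> (a *+ p, b0) \in g -> dv n a ->
    (forall s, s \in g -> ~ dv n.+1 (a + s.1)) ->
    (forall s, s \in g -> dv n s.1 -> ~ dv n.+2 ((a + s.1) *+ p)) ->
  extendible g a.
Proof.
move=> iso pag na ag nojump.
have : dv n.+1 b0 by apply/(partial_iso_dvd_pow iso _ pag)/dvd_pow_mulp.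
move=> /dvd_powS[b nb pb].
apply: (extendible_finite_height iso _ na nb) => //; first by rewrite pb.
move=> s sg hbs; have ns : dv n s.1.
  apply/(partial_iso_dvd_pow iso _ sg)/(dvd_pow_congr _ nb).
  exact: dvd_pow_le hbs.
apply: (nojump s sg ns).
have psg := partial_isoD iso pag (partial_isoMn iso p sg).
have := partial_iso_dvd_pow iso n.+2 psg; rewrite pair_mulrn /= -mulrnDl => ->.
by rewrite -pb -mulrnDl; apply: dvd_pow_mulp.
Qed.

(* [a] differs from an element [w] of the [n]-th Ulm quotient by a multiple of
   [p ^ n.+1]; counting in that quotient yields a partner for [w]. *)
Lemma extendible_jump n g a b0 :
    partial_iso p g -> (a *+ p, b0) \in g -> dv n a ->
    (forall s, s \in g -> ~ dv n.+1 (a + s.1)) -> dv n.+2 (a *+ p) ->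
  extendible g a.
Proof.
move=> iso pag na ag na2.
pose S := [seq s <- g | `[< dv n s.1 /\ dv n.+2 (s.1 *+ p) >]].
have memS s : s \in S <-> [/\ s \in g, dv n s.1 & dv n.+2 (s.1 *+ p)].
  rewrite mem_filter; split; first by case/andP => /asboolP[].
  by case=> -> ? ?; rewrite andbT; apply/asboolP.
(* When [x *+ p] is divisible by [p ^ n.+2], [v x] is a root of it of height above [n], so [x - v x]
   is p-torsion and congruent to [x] modulo [p ^ n.+1]. The value 0 elsewhere is a default. *)
have /choice[v vP] : forall x : A, exists v,
    dv n.+2 (x *+ p) -> dv n.+1 v /\ v *+ p = x *+ p.
  move=> x; have [/dvd_powS[v ? ?]|?] := pselect (dv n.+2 (x *+ p)).
    by exists v.
  by exists 0.
have vK x : dv n x -> dv n.+2 (x *+ p) ->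
    dv n (x - v x) /\ (x - v x) *+ p = 0.
  move=> nx /vP[nv pv]; split; last by rewrite mulrnBl pv subrr.
  by apply: dvd_powB => //; apply: dvd_pow_le nv.
have vB x y : dv n.+2 (x *+ p) -> dv n.+2 (y *+ p) ->
    dv n.+1 ((x - v x) - (y - v y)) <-> dv n.+1 (x - y).
  move=> /vP[nvx _] /vP[nvy _].
  rewrite opprB (addrC (v y)) addrACA dvd_pow_congl //.
  by apply: dvd_powD => //; apply: dvd_powN.
have [||||||||y [ny py] yS] := @at_least_fresh _ S A B
    (fun x => dv n x /\ x *+ p = 0) (fun x y => dv n.+1 (x - y)) _
    (fun x y => dv n.+1 (x - y)) (fun s => s.1 - v s.1) snd (a - v a)
    _ _ _ _ (@ulmAB n).
- by move=> x; rewrite subrr; apply: dvd_pow_zero.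
- by move=> x y /dvd_powN; rewrite opprB.
- by move=> x y /dvd_powN; rewrite opprB.
- by move=> x y z /dvd_powD h /h; rewrite addrA subrK.
- by move=> s /memS[_ ? ?]; apply: vK.
- move=> s t /memS[sg _ s2] /memS[tg _ t2] /(vB _ _ s2 t2).
  by have [+ _] := partial_iso_dvd_pow iso n.+1 (partial_isoB iso sg tg); apply.
- exact: vK.
- move=> s /memS[sg _ s2] /(vB _ _ na2 s2).
  exact: (ag _ (partial_isoN iso sg)).
have /dvd_powS[v' nv' pv'] : dv n.+2 b0.
  exact/(partial_iso_dvd_pow iso _ pag).
(* [y] represents a fresh class of the Ulm quotient of [B], and [v'] adjusts its multiple by [p] to
   [b0]. *)
apply: (@extendible_finite_height n g a (y + v')) => //.
- by rewrite mulrnDl py add0r pv'.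
- by apply: dvd_powD => //; apply: dvd_pow_le nv'.
move=> s sg; rewrite addrAC dvd_pow_congl // => nys.
have sNg := partial_isoN iso sg.
have nNs : dv n (- s).1.
  apply/(partial_iso_dvd_pow iso _ sNg)/dvd_powN.
  by apply/(dvd_pow_congr _ ny); apply: dvd_pow_le nys.
(* Against freshness, [- s] lies in [S] and its image in the class of [y]. *)
apply: (yS (- s)); last by rewrite -[(- s).2]/(- s.2) opprK.
apply/memS; split=> //.
have psNg := partial_isoMn iso p sNg.
have := partial_iso_dvd_pow iso n.+2 psNg; rewrite pair_mulrn /= => ->.
rewrite mulNrn; apply: dvd_powN.
by have := dvd_pow_mulp nys; rewrite mulrnDl py add0r.
Qed.

(** A coset of the finite domain without elements of infinite height has an element of largest
    height [n]. It then matters whether multiplication by [p] raises the height of some such element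
    by more than one. *)
Lemma extendible_step g a b0 :
  partial_iso p g -> (a *+ p, b0) \in g -> extendible g a.
Proof.
move=> iso pag.
have pasg s : s \in g -> ((a + s.1) *+ p, b0 + s.2 *+ p) \in g.
  move=> sg; have := partial_isoD iso pag (partial_isoMn iso p sg).
  by rewrite pair_mulrn mulrnDl.
have [[s sg infs]|no_inf] :=
    pselect (exists2 s, s \in g & dvd_inf p (a + s.1)).
  apply: (extendible_translate sg).
  exact: extendible_inf_height iso (pasg _ sg) infs.
have [N NP] : exists N, forall s, s \in g -> ~ dv N (a + s.1).
  have {no_inf} : forall s, s \in g -> exists n, ~ dv n (a + s.1).
    move=> s sg; apply: contrapT => h; apply: no_inf; exists s => // n.
    by apply: contrapT => hn; apply: h; exists n.
  elim: {iso pag pasg} g => [|s g IH] h; first by exists 0%N.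
  have [|N NP] := IH; first by move=> t tg; apply: h; rewrite inE tg orbT.
  have [n nP] := h s (mem_head _ _); exists (maxn n N) => t.
  rewrite inE => /orP[/eqP-> ht|tg ht].
    by apply: nP; apply: dvd_pow_le ht; apply: leq_maxl.
  by apply: (NP _ tg); apply: dvd_pow_le ht; apply: leq_maxr.
pose P N := `[< forall s, s \in g -> ~ dv N (a + s.1) >].
have exP : exists N, P N by exists N; apply/asboolP.
(* The least height not reached is positive, as everything is divisible by [p ^ 0]; its predecessor
   is reached. *)
have [[|n] /asboolP nP minn] := ex_minnP exP.
  by case: (nP _ (partial_iso0 iso)); apply: dvd_pow_exp0.
have [s sg ns] : exists2 s, s \in g & dv n (a + s.1).
  apply: contrapT => h; have : (n.+1 <= n)%N.
    by apply: minn; apply/asboolP => s sg hs; apply: h; exists s.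
  by rewrite ltnn.
apply: (extendible_translate sg).
have {}nP t : t \in g -> ~ dv n.+1 (a + s.1 + t.1).
  by move=> tg; rewrite -addrA; apply: (nP (s + t)); apply: (partial_isoD iso).
have [[t [tg nt jump]]|no_jump] := pselect (exists t, [/\ t \in g, dv n t.1
    & dv n.+2 ((a + s.1 + t.1) *+ p)]).
  apply: (extendible_translate tg).
  have pastg : ((a + s.1 + t.1) *+ p, b0 + (s + t).2 *+ p) \in g.
    by rewrite -addrA; apply: (pasg (s + t)); apply: (partial_isoD iso).
  apply: (extendible_jump iso pastg _ _ jump); first exact: dvd_powD.
  by move=> u ug; rewrite -addrA; apply: (nP (t + u)); apply: (partial_isoD iso).
apply: (extendible_no_jump iso (pasg _ sg) ns nP) => t tg nt jump.
by apply: no_jump; exists t.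
Qed.

(** Induction on the exponent of the order of [a]: adjoining [a *+ p] first leaves a single root to
    adjoin. *)
Lemma partial_iso_extend g a : partial_iso p g -> extendible g a.
Proof.
have [r] := pA a; elim: r a g => [|r IH] a g ar iso.
  rewrite expn0 in ar; exists g; split=> //; exists 0.
  by rewrite (_ : a = 0) //; apply: (partial_iso0 iso).
have [|g1 [iso1 sub1 [b0 pag]]] := IH (a *+ p) g _ iso.
  by rewrite -mulrnA -expnS.
have [g' [iso' sub' abg']] := extendible_step iso1 pag.
by exists g'; split=> // s /sub1/sub'.
Qed.
End Extension.

(** * The back-and-forth argument and types of tuples *)

Lemma partial_iso_sym p (A B : zmodType) (g : seq (A * B)) :
  partial_iso p g -> partial_iso p [seq (s.2, s.1) | s <- g].
Proof.
move=> iso; split.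
- by apply/mapP; exists 0; first exact: partial_iso0 iso.
- move=> _ _ /mapP[s sg ->] /mapP[t tg ->].
  by apply/mapP; exists (s - t); first exact: (partial_isoB iso).
move=> _ /mapP[s sg ->]; case: iso => _ _ /(_ s sg)[h0 hd] /=.
by split=> [|n]; split; [case: h0 | case: h0 | case: (hd n) | case: (hd n)].
Qed.

Lemma geval_partial_iso p (A B : zmodType) (g : seq (A * B)) n
    (v : n.-tuple A) (w : n.-tuple B) (t : gterm n) :
    partial_iso p g -> (forall i, (tnth v i, tnth w i) \in g) ->
  (geval v t, geval w t) \in g.
Proof.
move=> iso vw; elim: t => [i||t1 IH1 t2 IH2|t IH] /=; first exact: vw.
- exact: partial_iso0 iso.
- exact: (partial_isoD iso IH1 IH2).
- exact: (partial_isoN iso IH).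
Qed.

Lemma cons_tuple_mem (A B : zmodType) (g : seq (A * B)) n
    (v : n.-tuple A) (w : n.-tuple B) a b :
    (a, b) \in g -> (forall i, (tnth v i, tnth w i) \in g) ->
  forall i, (tnth (cons_tuple a v) i, tnth (cons_tuple b w) i) \in g.
Proof.
by move=> abg vw i; case: (unliftP ord0 i) => [j ->|->]; rewrite ?tnthS.
Qed.

Section BackAndForth.
Variables (p : nat) (A B : zmodType).
Hypotheses (p_pr : prime p).
Hypotheses (shortA : short_p_group p A) (shortB : short_p_group p B).
Hypothesis ulmAB : same_ulm p A B.

Lemma partial_iso_forth g (a : A) : partial_iso p g -> extendible p (B := B) g a.
Proof.
case: ulmAB => h hi; apply: partial_iso_extend => // [n N|N].
  by case: (h n N).
by case: (hi N).
Qed.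

Lemma partial_iso_back (g : seq (A * B)) (b : B) : partial_iso p g ->
  exists g', [/\ partial_iso p g', {subset g <= g'} & exists a, (a, b) \in g'].
Proof.
case: ulmAB => h hi iso.
have [||g' [iso' sub [a bag']]] := @partial_iso_extend p B A p_pr shortB shortA
    _ _ _ b (partial_iso_sym iso).
- by move=> n N /h.
- by move=> N /hi.
exists [seq (s.2, s.1) | s <- g']; split; first exact: partial_iso_sym.
  move=> s sg; apply/mapP; exists (s.2, s.1); last by case: s {sg}.
  by apply: sub; apply/mapP; exists s.
by exists a; apply/mapP; exists (b, a).
Qed.

(** Induction on the formula with the graph left general; enlarging the graph answers each
    quantified element. *)
Lemma gsat_partial_iso n (phi : gformula n) (v : n.-tuple A) (w : n.-tuple B) g :
    partial_iso p g -> (forall i, (tnth v i, tnth w i) \in g) ->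
  gsat phi v <-> gsat phi w.
Proof.
elim: phi v w g => {n} /=.
- move=> n t1 t2 v w g iso vw.
  exact: (partial_iso_eq iso (geval_partial_iso t1 iso vw)
    (geval_partial_iso t2 iso vw)).
- by move=> n f IH v w g iso vw; have := IH v w g iso vw; tauto.
- move=> n f1 IH1 f2 IH2 v w g iso vw.
  by have := IH1 v w g iso vw; have := IH2 v w g iso vw; tauto.
- move=> n f1 IH1 f2 IH2 v w g iso vw.
  by have := IH1 v w g iso vw; have := IH2 v w g iso vw; tauto.
- move=> n f1 IH1 f2 IH2 v w g iso vw.
  by have := IH1 v w g iso vw; have := IH2 v w g iso vw; tauto.
- move=> n f IH v w g iso vw; split=> h x.
    have [g' [iso' sub [a axg']]] := partial_iso_back x iso.
    have vw' := cons_tuple_mem axg' (fun i => sub _ (vw i)).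
    by have [+ _] := IH _ _ g' iso' vw'; apply; apply: h.
  have [g' [iso' sub [b xbg']]] := partial_iso_forth x iso.
  have vw' := cons_tuple_mem xbg' (fun i => sub _ (vw i)).
  by have [_] := IH _ _ g' iso' vw'; apply; apply: h.
- move=> n f IH v w g iso vw; split=> -[x h].
    have [g' [iso' sub [b xbg']]] := partial_iso_forth x iso.
    have vw' := cons_tuple_mem xbg' (fun i => sub _ (vw i)).
    by exists b; have [+ _] := IH _ _ g' iso' vw'; apply.
  have [g' [iso' sub [a axg']]] := partial_iso_back x iso.
  have vw' := cons_tuple_mem axg' (fun i => sub _ (vw i)).
  by exists a; have [_] := IH _ _ g' iso' vw'; apply.
Qed.

Lemma same_ulm_tp n (v : n.-tuple A) : exists w : n.-tuple B, tp v = tp w.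
Proof.
suff [w [g [iso vw]]] : exists (w : n.-tuple B) g,
    partial_iso p g /\ forall i, (tnth v i, tnth w i) \in g.
  exists w; apply/seteqP; split=> phi; rewrite /tp /=;
    by case: (gsat_partial_iso phi iso vw).
elim: n v => [|n IH] v.
  (* The empty tuple starts from the zero isomorphism. *)
  exists [tuple], [:: 0]; split=> [|[]//].
  split=> [|s t|s]; rewrite ?inE // => /eqP->; first by move=> /eqP->; rewrite subr0.
  by split=> // n; split=> _; apply: dvd_pow_zero.
have [w [g [iso vw]]] := IH (behead_tuple v).
have [g' [iso' sub [b abg']]] := partial_iso_forth (thead v) iso.
exists (cons_tuple b w), g'; split=> //; rewrite [v]tuple_eta.
exact: (cons_tuple_mem abg' (fun i => sub _ (vw i))).
Qed.
End BackAndForth.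

Lemma same_ulm_sym p (A B : zmodType) : same_ulm p A B -> same_ulm p B A.
Proof. by case=> h1 h2; split=> *; apply: iff_sym. Qed.

Lemma same_ulm_isotypic p (A B : zmodType) : prime p ->
  short_p_group p A -> short_p_group p B -> same_ulm p A B -> isotypic A B.
Proof.
move=> p_pr shA shB ulm; apply/seteqP; split=> _ [n [v ->]].
  by have [w ->] := same_ulm_tp p_pr shA shB ulm v; exists n, w.
by have [w ->] := same_ulm_tp p_pr shB shA (same_ulm_sym ulm) v; exists n, w.
Qed.

(** * Isotypy and first-order definability *)

Lemma isotypic_tp (A B : zmodType) n (v : n.-tuple A) :
  isotypic A B -> exists w : n.-tuple B, tp v = tp w.
Proof.
move=> AB; have : types A (existT _ n (tp v)) by exists n, v.
rewrite AB => -[m [w eqT]].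
(* The lengths must be identified before the types can be compared. *)
have eq_nm : n = m by exact: (congr1 (@projT1 _ _) eqT).
by move: w eqT; case: m / eq_nm => w eqT; exists w; apply: eq_from_Tagged eqT.
Qed.

(** The theory of a group is the type of its empty tuple. *)
Lemma isotypic_elementarily_equivalent (A B : zmodType) :
  isotypic A B -> elementarily_equivalent A B.
Proof.
move=> AB; have [w] := isotypic_tp ([tuple] : 0.-tuple A) AB.
by rewrite (tuple0 w).
Qed.

(** One formula serves all groups, which is what allows transfer between two of them. *)
Definition definable n (P : forall G : zmodType, n.-tuple G -> Prop) : Prop :=
  exists phi : gformula n, forall G v, gsat phi v <-> P G v.

Section Definable.
Variable n : nat.
Implicit Types P Q : forall G : zmodType, n.-tuple G -> Prop.

Lemma definable_eq (t1 t2 : gterm n) :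
  definable (fun G v => geval v t1 = geval v t2).
Proof. by exists (FEq t1 t2). Qed.

Lemma definable_and P Q : definable P -> definable Q ->
  definable (fun G v => P G v /\ Q G v).
Proof.
case=> f fP [h hQ]; exists (FAnd f h) => G v /=.
by have := fP G v; have := hQ G v; tauto.
Qed.

Lemma definable_imp P Q : definable P -> definable Q ->
  definable (fun G v => P G v -> Q G v).
Proof.
case=> f fP [h hQ]; exists (FImp f h) => G v /=.
by have := fP G v; have := hQ G v; tauto.
Qed.

(** Serves for conclusions such as [i = j] between indices, whose truth does not depend on the
    group. *)
Lemma definable_prop (Q : Prop) : definable (fun (G : zmodType) (_ : n.-tuple G) => Q).
Proof.
have [q|nq] := pselect Q.
  by exists (FEq (@GOne n) (@GOne n)) => G v /=.
by exists (FNot (FEq (@GOne n) (@GOne n))) => G v /=; split.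
Qed.

Lemma definable_all_fin (I : finType)
    (P : I -> forall G : zmodType, n.-tuple G -> Prop) :
  (forall i, definable (P i)) -> definable (fun G v => forall i, P i G v).
Proof.
move=> defP; suff [f fP] : exists f : gformula n, forall G v,
    gsat f v <-> forall i, i \in enum I -> P i G v.
  exists f => G v; apply: iff_trans (fP G v) _.
  by split=> h i; [apply: h; rewrite mem_enum | move=> _; apply: h].
elim: (enum I) => [|i s [f fP]].
  by have [f fP] := definable_prop True; exists f => G v; apply: iff_trans (fP G v) _.
have [f' fP'] := definable_and (defP i) (ex_intro _ f fP).
exists f' => G v; apply: iff_trans (fP' G v) _; split=> [[h1 h2] j|h].
  by rewrite inE => /orP[/eqP->//|]; apply: h2.
by split=> [|j js]; apply: h; rewrite inE ?eqxx ?js ?orbT.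
Qed.
End Definable.

Lemma definable_ex n (P : forall G : zmodType, n.+1.-tuple G -> Prop) :
  definable P -> definable (fun G v => exists x, P G (cons_tuple x v)).
Proof.
by case=> f fP; exists (FEx f) => G v /=; split=> -[x] /fP h; exists x.
Qed.

Lemma definable_ex_tuple n (P : forall G : zmodType, n.-tuple G -> Prop) :
  definable P ->
  definable (fun (G : zmodType) (_ : 0.-tuple G) => exists v, P G v).
Proof.
elim: n P => [|n IH] P defP.
  have [f fP] := defP; exists f => G v; apply: iff_trans (fP G v) _.
  by split=> [h|[w]]; [exists v | rewrite (tuple0 v) (tuple0 w)].
have [f fP] := IH _ (definable_ex defP).
exists f => G v; apply: iff_trans (fP G v) _; split=> [[w [x h]]|[w h]].
  by exists (cons_tuple x w).
exists (behead_tuple w), (thead w); congr (P G _): h.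
exact: tuple_eta.
Qed.

Fixpoint gterm_lift n (t : gterm n) : gterm n.+1 :=
  match t with
  | GVar i => GVar (lift ord0 i)
  | GOne => GOne _
  | GMul t1 t2 => GMul (gterm_lift t1) (gterm_lift t2)
  | GInv t1 => GInv (gterm_lift t1)
  end.

Lemma geval_lift (G : zmodType) n (v : n.-tuple G) x (t : gterm n) :
  geval (cons_tuple x v) (gterm_lift t) = geval v t.
Proof.
by elim: t => [i||t1 IH1 t2 IH2|t IH] /=; rewrite ?tnthS ?IH1 ?IH2 ?IH.
Qed.

Definition gterm_muln n (t : gterm n) k : gterm n := iter k (GMul t) (GOne n).

Lemma geval_muln (G : zmodType) n (v : n.-tuple G) (t : gterm n) k :
  geval v (gterm_muln t k) = geval v t *+ k.
Proof. by elim: k => [|k IH] /=; rewrite ?mulrS ?IH. Qed.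

Lemma definable_dvd_pow p k n (t : gterm n) :
  definable (fun G v => dvd_pow p k (geval v t)).
Proof.
exists (FEx (FEq (gterm_lift t) (gterm_muln (GVar ord0) (p ^ k)))) => G v /=.
by split=> -[x h]; exists x; move: h; rewrite geval_lift geval_muln.
Qed.

(** The family of witnesses becomes an [N]-tuple bound by [N] existential quantifiers. *)
Lemma definable_at_least N (P : forall G : zmodType, G -> Prop)
    (E : forall G : zmodType, G -> G -> Prop) :
    (forall n (t : gterm n), definable (fun G v => P G (geval v t))) ->
    (forall n (t1 t2 : gterm n),
      definable (fun G v => E G (geval v t1) (geval v t2))) ->
  definable (fun (G : zmodType) (_ : 0.-tuple G) => at_least N (P G) (E G)).
Proof.
move=> defP defE; pose Q (G : zmodType) (v : N.-tuple G) :=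
  (forall i, P G (tnth v i)) /\
  (forall i j, E G (tnth v i) (tnth v j) -> i = j).
have [f fQ] : definable (fun (G : zmodType) (_ : 0.-tuple G) => exists v, Q G v).
  apply: definable_ex_tuple; apply: definable_and.
    by apply: definable_all_fin => i; apply: defP (GVar i).
  apply: definable_all_fin => i; apply: definable_all_fin => j.
  by apply: definable_imp; [apply: defE (GVar i) (GVar j) | apply: definable_prop].
exists f => G v; apply: iff_trans (fQ G v) _; split=> [[w [hP hE]]|[x [hP hE]]].
  by exists (tnth w).
exists [tuple x i | i < N]; split=> [i|i j]; rewrite !tnth_mktuple //.
exact: hE.
Qed.

Lemma elementarily_equivalent_definable (A B : zmodType)
    (P : forall G : zmodType, 0.-tuple G -> Prop) :
    elementarily_equivalent A B -> definable P ->
  P A [tuple] <-> P B [tuple].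
Proof.
move=> AB [f fP]; have : theory A f <-> theory B f by rewrite AB.
by rewrite /theory /= !fP.
Qed.

Lemma tp_definable (A B : zmodType) n (v : n.-tuple A) (w : n.-tuple B)
    (P : forall G : zmodType, n.-tuple G -> Prop) :
  tp v = tp w -> definable P -> P A v <-> P B w.
Proof.
move=> vw [f fP]; have : tp v f <-> tp w f by rewrite vw.
by rewrite /tp /= !fP.
Qed.

Lemma definable_p_torsion p n (t : gterm n) :
  definable (fun G v => geval v t *+ p = 0).
Proof.
have [f fP] := definable_eq (gterm_muln t p) (GOne n).
by exists f => G v; apply: iff_trans (fP G v) _; rewrite geval_muln.
Qed.

Lemma ulm_at_least_ee p n N (A B : zmodType) : elementarily_equivalent A B ->
  ulm_at_least p n N A <-> ulm_at_least p n N B.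
Proof.
move=> AB; apply: (elementarily_equivalent_definable AB
  (P := fun G _ => ulm_at_least p n N G)).
apply: definable_at_least => [m t|m t1 t2].
  by apply: definable_and; [apply: definable_dvd_pow | apply: definable_p_torsion].
exact: (definable_dvd_pow p n.+1 (GMul t1 (GInv t2))).
Qed.

(** Infinite height is an infinite conjunction of formulas. The type of one tuple of witnesses
    contains them all, together with the torsion and distinctness conditions. *)
Lemma ulm_inf_at_least_isotypic p N (A B : zmodType) : isotypic A B ->
  ulm_inf_at_least p N A -> ulm_inf_at_least p N B.
Proof.
move=> AB [x [hx injx]].
have [w xw] := isotypic_tp [tuple x i | i < N] AB.
have tx i : tnth [tuple x i | i < N] i = x i by rewrite tnth_mktuple.
exists (tnth w); split=> [i|i j wij].
  have [infx px] := hx i; split=> [n|].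
    have [+ _] := tp_definable xw (definable_dvd_pow p n (GVar i)).
    by rewrite /= tx; apply; apply: infx.
  have [+ _] := tp_definable xw (definable_p_torsion p (GVar i)).
  by rewrite /= tx; apply.
have [_] := tp_definable xw (definable_eq (GVar i) (GVar j)).
by rewrite /= !tx => /(_ wij)/injx.
Qed.

(** * Purity, divisible quotients and direct sums of cyclic groups *)

Lemma subgroup_valMn (A : zmodType) (S : zmodClosed A) (x : subgroup_type S) n :
  val (x *+ n) = val x *+ n.
Proof. exact: raddfMn. Qed.

Lemma p_group_subgroup p (A : zmodType) (S : zmodClosed A) :
  p_group p A -> p_group p (subgroup_type S).
Proof.
move=> pA x; have [r xr] := pA (val x); exists r.
by apply: val_inj; rewrite subgroup_valMn.
Qed.

Lemma divisible_subgroupP (A : zmodType) (D : zmodClosed A) n (x : A) :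
    divisible (subgroup_type D) -> (0 < n)%N -> x \in D ->
  exists2 y, y \in D & y *+ n = x.
Proof.
move=> divD n_gt0 xD; have [y yx] := divD n (Sub x xD) n_gt0.
by exists (val y); [apply: valP | rewrite -subgroup_valMn yx SubK].
Qed.

Lemma pureP (A : zmodType) (B : zmodClosed A) n (u : A) :
  pure B -> u *+ n \in B -> exists2 b, b \in B & b *+ n = u *+ n.
Proof.
move=> pureB uB.
have : ([set g : A | g \in B] `&` range (fun a : A => a *~ n))%classic (u *+ n).
  by split=> //; exists u.
by rewrite -pureB => -[b bB bu]; exists b.
Qed.

Lemma ideal_quot_divisibleP (A : zmodType) (B : zmodClosed A) n (a : A) :
    divisible {ideal_quot B} -> (0 < n)%N ->
  exists2 b, b \in B & exists x, a = b + x *+ n.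
Proof.
move=> divAB n_gt0; have [q] := divAB n (\pi_{ideal_quot B} a)%qT n_gt0.
elim/quotW: q => x; rewrite -raddfMn => /eqP; rewrite -Quotient.idealrBE => h.
exists (a - x *+ n); first by rewrite -opprB rpredN.
by exists x; rewrite subrK.
Qed.

(** All heights are infinite, so each finite Ulm quotient has a single class. *)
Lemma ulm_at_least_divisible p n N (G : zmodType) : prime p -> divisible G ->
  ulm_at_least p n N G <-> (N <= 1)%N.
Proof.
move=> p_pr divG; have dv m (x : G) : dvd_pow p m x.
  have [|u <-] := divG (p ^ m)%N x; first by rewrite expn_gt0 prime_gt0.
  by exists u.
split=> [[x [_ injx]]|leN1].
  case: N x injx => [|[|N]] // x injx.
  by have := injx ord0 ord_max (dv _ _); move/(congr1 val).
exists (fun _ => 0); split=> [i|i j _]; first by rewrite mul0rn.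
apply: val_inj; case: i j => [i ltiN] [j ltjN] /=.
by case: i j ltiN ltjN => [|i] [|j] /leq_trans h1 /leq_trans h2 //;
  [have := h2 _ leN1 | have := h1 _ leN1 | have := h1 _ leN1].
Qed.

Lemma cyclic_p_group_bounded p (G : zmodType) : cyclic_group G -> p_group p G ->
  exists r, forall x : G, x *+ p ^ r = 0.
Proof.
move=> [g gG] pG; have [r gr] := pG g; exists r => x.
have [k ->] := gG x.
by rewrite pmulrn mulrzAC -pmulrn gr mul0rz.
Qed.

Lemma big_uniq_subset (I : eqType) (G : zmodType) (s t : seq I) (f : I -> G) :
    uniq s -> uniq t -> {subset s <= t} ->
  \sum_(i <- t) (if i \in s then f i else 0) = \sum_(i <- s) f i.
Proof.
move=> us ut sst; rewrite -big_mkcond -big_filter; apply: perm_big.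
apply: uniq_perm => // [|i]; first exact: filter_uniq.
by rewrite mem_filter; apply: andb_idr; apply: sst.
Qed.

(** The finitely many cyclic summands met by [x] are killed by a common [p ^ n]. Writing [x] as a
    multiple by [p ^ n] and comparing components makes each one vanish. *)
Lemma direct_sum_cyclic_dvd_inf p (G : zmodType) (x : G) :
  direct_sum_of_cyclic_p_groups p G -> dvd_inf p x -> x = 0.
Proof.
move=> [I [C [[genC freeC] cycC]]] infx.
have /choice[r rP] : forall i, exists r, forall y, y \in C i -> y *+ p ^ r = 0.
  move=> i; have [cyc pC] := cycC i.
  have [r rP] := cyclic_p_group_bounded cyc pC.
  exists r => y yC; have /(congr1 val) := rP (Sub y yC).
  by rewrite subgroup_valMn SubK.
have [s [f [us fC def_x]]] := genC x.
pose n := (\max_(i <- s) r i)%N.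
have [u def_xu] := infx n; have [s' [h [us' hC def_u]]] := genC u.
pose t := undup (s ++ s').
(* The difference of the two decompositions, padded by 0 to the common support [t]. *)
pose F i := (if i \in s then f i else 0) - (if i \in s' then h i else 0) *+ p ^ n.
have FC i : F i \in C i.
  by apply: rpredB; [|apply: rpredMn]; case: ifP => // _; apply: rpred0.
have st : {subset s <= t} by move=> i; rewrite mem_undup mem_cat => ->.
have s't : {subset s' <= t} by move=> i; rewrite mem_undup mem_cat orbC => ->.
have F0 : \sum_(i <- t) F i = 0.
  rewrite sumrB sumrMnl !big_uniq_subset ?undup_uniq //.
  by rewrite -def_x -def_u -def_xu subrr.
rewrite def_x big1_seq // => i /= si.
have := freeC t F (undup_uniq _) FC F0 i (st _ si).
rewrite /F si => /eqP; rewrite subr_eq0 => /eqP->.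
have le_rn : (r i <= n)%N by apply: leq_bigmax_seq.
rewrite -(subnKC le_rn) expnD mulrnA rP ?mul0rn //.
by case: ifP => // _; apply: rpred0.
Qed.

(** * Ulm invariants of the divisible part and of basic subgroups *)

Section Parts.
Variables (p : nat) (A : zmodType) (D R B : zmodClosed A).
Hypotheses (p_pr : prime p) (pA : p_group p A).
Hypotheses (hDR : divisible_reduced_parts D R).
Hypotheses (sepR : separable p (subgroup_type R)).
Hypotheses (hB : basic_subgroup p B).

(** Roots of [a] project to roots in [R] of its reduced component, which is therefore 0 by
    separability; conversely [D] is divisible. *)
Lemma dvd_inf_divisible_part (a : A) : dvd_inf p a <-> a \in D.
Proof.
case: hDR => DR DR0 divD _; split=> [infa|aD n]; last first.
  have [|y _ <-] := @divisible_subgroupP _ _ (p ^ n) a divD _ aD; last by exists y.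
  by rewrite expn_gt0 prime_gt0.
have [d [r [dD rR def_a]]] := DR a.
suff r0 : r = 0 by rewrite def_a r0 addr0.
apply: contrapT => /eqP nz_r; case: sepR => _; apply.
exists (Sub r rR); split=> [|n].
  by apply: contra nz_r => /eqP/(congr1 val); rewrite SubK => ->.
have [u def_u] := infa n; have [d' [r' [d'D r'R def_u']]] := DR u.
exists (Sub r' r'R); apply: val_inj; rewrite subgroup_valMn !SubK.
apply/eqP; rewrite -subr_eq0; apply/eqP; apply: DR0; last first.
  by apply: rpredB => //; apply: rpredMn.
(* The difference also lies in [D], which meets [R] only in 0. *)
have -> : r' *+ p ^ n - r = d - d' *+ p ^ n.
  apply/eqP; rewrite subr_eq addrAC eq_sym subr_eq [eqbRHS]addrC.
  by rewrite -mulrnDl -def_u' -def_u -def_a.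
by apply: rpredB => //; apply: rpredMn.
Qed.

Lemma short_p_group_ambient : short_p_group p A.
Proof.
split=> // x /dvd_inf_divisible_part xD; case: hDR => _ _ divD _.
have [y yD yx] := divisible_subgroupP divD (prime_gt0 p_pr) xD.
by exists y => //; apply/dvd_inf_divisible_part.
Qed.

Lemma dvd_inf_divisible_subgroup (x : subgroup_type D) : dvd_inf p x.
Proof.
case: hDR => _ _ divD _ n.
have [|y <-] := divD (p ^ n)%N x; first by rewrite expn_gt0 prime_gt0.
by exists y.
Qed.

Lemma short_p_group_divisible_part : short_p_group p (subgroup_type D).
Proof.
split=> [|x _]; first exact: p_group_subgroup.
case: hDR => _ _ divD _; have [y yx] := divD p x (prime_gt0 p_pr).
by exists y => //; apply: dvd_inf_divisible_subgroup.
Qed.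

Lemma short_p_group_basic : short_p_group p (subgroup_type B).
Proof.
case: hB => _ sumB _; split=> [|x /(direct_sum_cyclic_dvd_inf sumB) ->].
  exact: p_group_subgroup.
by exists 0; [move=> n; apply: dvd_pow_zero | rewrite mul0rn].
Qed.

Lemma ulm_inf_divisible_part N :
  ulm_inf_at_least p N A <-> ulm_inf_at_least p N (subgroup_type D).
Proof.
split=> -[x [hx injx]].
  have xD i : x i \in D by apply/dvd_inf_divisible_part; case: (hx i).
  exists (fun i => Sub (x i) (xD i)); split=> [i|i j].
    split; first exact: dvd_inf_divisible_subgroup.
    by apply: val_inj; rewrite subgroup_valMn SubK; case: (hx i).
  by move/(congr1 val); rewrite !SubK; apply: injx.
exists (fun i => val (x i)); split=> [i|i j /val_inj]; last exact: injx.
split; first by apply/dvd_inf_divisible_part/valP.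
by rewrite -subgroup_valMn; case: (hx i) => _ ->.
Qed.

(** By purity, a root in [A] of an element of [B] can be replaced by one in [B]. *)
Lemma dvd_pow_basic n (x : subgroup_type B) :
  dvd_pow p n x <-> dvd_pow p n (val x).
Proof.
split=> -[u def_x].
  by exists (val u); rewrite def_x subgroup_valMn.
case: hB => pureB _ _.
have [|b bB bu] := @pureP _ B (p ^ n) u pureB; first by rewrite -def_x; apply: valP.
by exists (Sub b bB); apply: val_inj; rewrite subgroup_valMn SubK bu.
Qed.

(** Gives surjectivity from the Ulm quotient of [B] to that of [A]. Divisibility of [A/B] yields
    [a = b + a' *+ p], and purity corrects [b] so that its multiple by [p ^ n] becomes p-torsion. *)
Lemma ulm_basic_approx n (x : A) : dvd_pow p n x -> x *+ p = 0 ->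
  exists y : subgroup_type B,
    [/\ dvd_pow p n y, y *+ p = 0 & dvd_pow p n.+1 (x - val y)].
Proof.
case: hB => pureB _ divAB [a ->] pa.
have [|b bB [a' def_a]] := @ideal_quot_divisibleP _ _ p a divAB.
  exact: prime_gt0.
have pb : b *+ p ^ n.+1 = (- a') *+ p ^ n.+2.
  move: pa; rewrite -mulrnA -expnSr def_a mulrnDl -mulrnA -expnS mulNrn.
  by move/eqP; rewrite addr_eq0 => /eqP.
have [|b' b'B b'E] := @pureP _ B (p ^ n.+2) (- a') pureB.
  by rewrite -pb; apply: rpredMn.
(* As [b] and [b' *+ p] agree after multiplication by [p ^ n.+1], [y *+ p ^ n] is p-torsion; it
   differs from [x] by [(a' + b') *+ p ^ n.+1]. *)
pose y := b - b' *+ p.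
have yB : y \in B by apply: rpredB => //; apply: rpredMn.
exists (Sub (y *+ p ^ n) (rpredMn _ yB)); split.
- by apply/dvd_pow_basic; rewrite SubK; exists y.
- apply: val_inj; rewrite subgroup_valMn SubK -mulrnA -expnSr mulrnBl pb -b'E.
  by rewrite -mulrnA -expnS subrr.
rewrite SubK -mulrnBl; exists (a' + b').
rewrite expnS mulrnA; congr (_ *+ _).
by rewrite def_a /y opprB mulrnDl addrACA addrC addrA subrK addrC.
Qed.

Lemma ulm_basic n N : ulm_at_least p n N A <-> ulm_at_least p n N (subgroup_type B).
Proof.
split=> -[x [hx injx]].
  have /choice[y yP] : forall i, exists y : subgroup_type B,
      [/\ dvd_pow p n y, y *+ p = 0 & dvd_pow p n.+1 (x i - val y)].
    by move=> i; case: (hx i); apply: ulm_basic_approx.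
  exists y; split=> [i|i j]; first by case: (yP i).
  move/dvd_pow_basic; rewrite raddfB => yij; apply: injx.
  have [_ _ xi] := yP i; have [_ _ xj] := yP j.
  have -> : x i - x j = (x i - val (y i)) + (val (y i) - val (y j))
      - (x j - val (y j)) by rewrite addrA subrK opprB addrA subrK.
  by apply: dvd_powB => //; apply: dvd_powD.
exists (fun i => val (x i)); split=> [i|i j].
  have [/dvd_pow_basic nx px] := hx i.
  by rewrite -subgroup_valMn px.
by rewrite -raddfB => /dvd_pow_basic; apply: injx.
Qed.
End Parts.

(** * Transfer of the invariants and conclusion *)

Lemma ulm_inf_at_least_divisible p N (G : zmodType) :
    prime p -> divisible G ->
  ulm_inf_at_least p N G <->
  at_least N (fun x : G => x *+ p = 0) eq.
Proof.
move=> p_pr divG; split=> -[x [hx injx]]; exists x; split=> // i.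
  by case: (hx i).
split=> // n; have [|u <-] := divG (p ^ n)%N (x i); last by exists u.
by rewrite expn_gt0 prime_gt0.
Qed.

(** In a divisible group the count is that of the p-torsion elements, which is first-order. *)
Lemma ulm_inf_at_least_ee p N (G H : zmodType) :
    prime p -> divisible G -> divisible H -> elementarily_equivalent G H ->
  ulm_inf_at_least p N G <-> ulm_inf_at_least p N H.
Proof.
move=> p_pr divG divH GH; rewrite !ulm_inf_at_least_divisible //.
apply: (elementarily_equivalent_definable GH
  (P := fun G _ => at_least N (fun x : G => x *+ p = 0) eq)).
apply: definable_at_least => n t; first exact: definable_p_torsion.
exact: definable_eq.
Qed.

(** The family in [G] has at most one member, so the constant family 0 suffices in [H]. *)
Lemma ulm_inf_at_least_trivial p N (G H : zmodType) :
    (forall x : G, dvd_inf p x -> x = 0) ->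
  ulm_inf_at_least p N G -> ulm_inf_at_least p N H.
Proof.
move=> G0 [x [hx injx]]; exists (fun _ => 0); split=> [i|i j _].
  by split=> [n|]; [apply: dvd_pow_zero | rewrite mul0rn].
by apply: injx; rewrite (G0 _ (hx i).1) (G0 _ (hx j).1).
Qed.

Theorem theorem5p1 (p : nat) (A1 A2 : zmodType)
  (D1 R1 B1 : zmodClosed A1) (D2 R2 B2 : zmodClosed A2)
  (hp : prime p)
  (hA1 : p_group p A1) (hA2 : p_group p A2)
  (hDR1 : divisible_reduced_parts D1 R1)
  (hDR2 : divisible_reduced_parts D2 R2)
  (hsep1 : separable p (subgroup_type R1))
  (hsep2 : separable p (subgroup_type R2))
  (hB1 : basic_subgroup p B1) (hB2 : basic_subgroup p B2) :
  isotypic A1 A2 <->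
  elementarily_equivalent (subgroup_type D1) (subgroup_type D2) /\
  elementarily_equivalent (subgroup_type B1) (subgroup_type B2).
Proof.
have shA1 := short_p_group_ambient hp hA1 hDR1 hsep1.
have shA2 := short_p_group_ambient hp hA2 hDR2 hsep2.
have ulmB1 := ulm_basic hp hB1; have ulmB2 := ulm_basic hp hB2.
have infD1 := ulm_inf_divisible_part hp hDR1 hsep1.
have infD2 := ulm_inf_divisible_part hp hDR2 hsep2.
have [_ _ divD1 _] := hDR1; have [_ _ divD2 _] := hDR2.
have [_ sumB1 _] := hB1; have [_ sumB2 _] := hB2.
split=> [A12|[D12 B12]]; last first.
  apply: (same_ulm_isotypic hp shA1 shA2); split=> [n N|N].
    rewrite ulmB1 ulmB2; exact: ulm_at_least_ee.
  rewrite infD1 infD2; exact: ulm_inf_at_least_ee.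
split; apply: isotypic_elementarily_equivalent.
  apply: (same_ulm_isotypic hp (short_p_group_divisible_part hp hA1 hDR1)
    (short_p_group_divisible_part hp hA2 hDR2)).
  (* Finite invariants of divisible groups are trivial; the infinite ones are those of the ambient
     groups. *)
  split=> [n N|N]; first by rewrite !ulm_at_least_divisible.
  rewrite -infD1 -infD2; split; apply: ulm_inf_at_least_isotypic.
    exact: A12.
  by rewrite /isotypic A12.
apply: (same_ulm_isotypic hp (short_p_group_basic hA1 hB1)
  (short_p_group_basic hA2 hB2)).
split=> [n N|N].
  rewrite -ulmB1 -ulmB2; apply: ulm_at_least_ee.
  exact: isotypic_elementarily_equivalent.
by split; apply: ulm_inf_at_least_trivial => x; apply: direct_sum_cyclic_dvd_inf.
Qed.
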